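(* Suppose $M/N$ is a split H-separable extension of central $k$-algebras such that the centralizer $U=C_M(N)$ is Kanzaki separable. Then $M/N$ is a depth $2$ strongly separable extension; that is, there is an $N$-$N$-bimodule map $E:M\to N$ with respect to which $M/N$ is strongly separable and has depth $2$.
   Context: $k$ is a field and algebras are unital associative $k$-algebras; $C_X(Y)$ is the centralizer of $Y$ in $X$; summation over repeated indices is understood. An algebra is central if its center is $k1$. $M/N$ is split if $N$ is isomorphic to an $N$-bimodule direct summand of $M$. $M/N$ is H-separable if there are finitely many $f_i\in(M\otimes_NM)^M=\{f\in M\otimes_NM: mf=fm\ \forall m\in M\}$ and $u_i\in U=C_M(N)$ such that $1\otimes1=u_if_i$ in $M\otimes_NM$. A $k$-algebra is Kanzaki separable if it has a separability element that is symmetric (invariant under the flip). $M/N$ is strongly separable of index $\lambda^{-1}$ if there are an $N$-$N$-bimodule map $E:M\to N$ with $E(1)=1$ and finite families $\{x_i\},\{y_i\}$ in $M$ (dual bases for $E$) with $E(mx_i)y_i=m=x_iE(y_im)$ for all $m\in M$ and $x_iy_i=\lambda^{-1}1$, $0\ne\lambda\in k$. Basic construction: $M_1=M\otimes_NM$, $e_1=1\otimes1$, $me_1m'=m\otimes m'$, product $(me_1m')(ne_1n')=mE(m'n)e_1n'$, unit $x_ie_1y_i$, $M\subset M_1$ via $m\mapsto mx_ie_1y_i$, $E_M:M_1\to M$, $E_M(me_1m')=\lambda mm'$; $M_1/M$ is again strongly separable of index $\lambda^{-1}$. Iterating for $M_1/M$ gives $M_2=M_1e_2M_1$ with $E_{M_1}:M_2\to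 M_1$, $E_{M_1}(xe_2y)=\lambda xy$. $M/N$ has depth $2$ (with respect to $E$) if $E_M$ has dual bases lying in $A=C_{M_1}(N)$ and $E_{M_1}$ has dual bases lying in $B=C_{M_2}(M)$. *)

(* Defs.v *)
From HB Require Import structures.
From mathcomp Require Import all_boot all_algebra generic_quotient.
From mathcomp Require Import boolp.

Set Implicit Arguments.
Unset Strict Implicit.
Unset Printing Implicit Defensive.
Import GRing.Theory.
Local Open Scope ring_scope.
Local Open Scope quotient_scope.

(* An extension M/N is a morphism iota : N -> M; a subalgebra N of M is the   *)
(* case of an injective iota.  Elements of M (x)_N M are represented by lists *)
(* of pairs, [:: (m1, n1); ...; (mr, nr)] standing for the sum of the         *)
(* mi (x) ni.                                                                 *)

Section TensorRelation.
Variables (k : fieldType) (N : nzRingType) (M : algType k).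
Variable iota : {rmorphism N -> M}.

(* (m, 0) ~ nil follows from [tr_bal] and [tr_0].                             *)
Inductive tensor_rel : seq (M * M) -> seq (M * M) -> Prop :=
| tr_refl s : tensor_rel s s
| tr_sym s t : tensor_rel s t -> tensor_rel t s
| tr_trans s t u : tensor_rel s t -> tensor_rel t u -> tensor_rel s u
| tr_cat s1 s2 t1 t2 : tensor_rel s1 t1 -> tensor_rel s2 t2 ->
    tensor_rel (s1 ++ s2) (t1 ++ t2)
| tr_catC s t : tensor_rel (s ++ t) (t ++ s)
| tr_0 n : tensor_rel [:: (0, n)] [::]
| tr_addl m m' n : tensor_rel [:: (m + m', n)] [:: (m, n); (m', n)]
| tr_addr m n n' : tensor_rel [:: (m, n + n')] [:: (m, n); (m, n')]
| tr_bal m x n : tensor_rel [:: (m * iota x, n)] [:: (m, iota x * n)].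

Definition tensor_relb : rel (seq (M * M)) := fun s t => `[< tensor_rel s t >].

Fact tensor_relb_refl : reflexive tensor_relb.
Proof. by move=> s; apply/asboolP; exact: tr_refl. Qed.

Fact tensor_relb_sym : symmetric tensor_relb.
Proof. by move=> s t; apply/asboolP/asboolP; exact: tr_sym. Qed.

Fact tensor_relb_trans : transitive tensor_relb.
Proof.
by move=> t s u /asboolP st /asboolP tu; apply/asboolP; exact: tr_trans tu.
Qed.

Canonical tensor_equiv :=
  EquivRel tensor_relb tensor_relb_refl tensor_relb_sym tensor_relb_trans.

Definition tensor := {eq_quot tensor_equiv}.
HB.instance Definition _ := Choice.on tensor.

Definition tens_of (s : seq (M * M)) : tensor := \pi_tensor s.

Lemma tens_ofP s t : tens_of s = tens_of t <-> tensor_rel s t.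
Proof.
by split=> [/eqP|H]; [rewrite piE => /asboolP | apply/eqP; rewrite piE; apply/asboolP].
Qed.

Lemma tens_ofK t : tens_of (repr t) = t.
Proof. exact: reprK. Qed.

Definition tens (m n : M) : tensor := tens_of [:: (m, n)].

Definition tensor_add (s t : tensor) : tensor := tens_of (repr s ++ repr t).

Definition tensor_opp (s : tensor) : tensor :=
  tens_of [seq (- p.1, p.2) | p <- repr s].

Lemma tensor_addE s t : tensor_add (tens_of s) (tens_of t) = tens_of (s ++ t).
Proof. by apply/tens_ofP/tr_cat; apply/tens_ofP; rewrite tens_ofK. Qed.

Fact tensor_addA : associative tensor_add.
Proof.
move=> s t u; rewrite -(tens_ofK s) -(tens_ofK t) -(tens_ofK u).
by rewrite !tensor_addE catA.
Qed.

Fact tensor_addC : commutative tensor_add.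
Proof.
move=> s t; rewrite -(tens_ofK s) -(tens_ofK t) !tensor_addE.
by apply/tens_ofP/tr_catC.
Qed.

Fact tensor_add0 : left_id (tens_of [::]) tensor_add.
Proof. by move=> s; rewrite -(tens_ofK s) tensor_addE. Qed.

Fact tensor_addN : left_inverse (tens_of [::]) tensor_opp tensor_add.
Proof.
move=> s; rewrite -[X in tensor_add _ X]tens_ofK tensor_addE.
elim: (repr s) => [//|[m n] l IH] /=.
apply/tens_ofP; have /tens_ofP {}IH := IH.
set l' := map _ l in IH *.
apply: (@tr_trans _ ([:: (- m, n); (m, n)] ++ (l' ++ l))).
  rewrite /= -[_ :: _ ++ _]/([:: (- m, n)] ++ _) -[X in tensor_rel _ X]/([:: (- m, n)] ++ _).
  apply: tr_cat; first exact: tr_refl.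
  rewrite -cat1s catA -[X in tensor_rel _ X]/(([:: (m, n)] ++ l') ++ l).
  by apply: tr_cat; [exact: tr_catC | exact: tr_refl].
rewrite -[X in tensor_rel _ X]/([::] ++ [::]); apply: tr_cat => //.
apply: (@tr_trans _ [:: (- m + m, n)]); first exact/tr_sym/tr_addl.
by rewrite addNr; exact: tr_0.
Qed.

HB.instance Definition _ := GRing.isZmodule.Build tensor
  tensor_addA tensor_addC tensor_add0 tensor_addN.

Lemma tens_of_cat s t : tens_of (s ++ t) = tens_of s + tens_of t.
Proof. by rewrite -tensor_addE. Qed.

Lemma tens_ofE s : tens_of s = \sum_(p <- s) tens p.1 p.2.
Proof.
elim: s => [|[m n] s IH]; first by rewrite big_nil.
by rewrite big_cons -IH -cat1s tens_of_cat.
Qed.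

Lemma tensorE t : t = \sum_(p <- repr t) tens p.1 p.2.
Proof. by rewrite -tens_ofE tens_ofK. Qed.

Lemma tensDl m m' n : tens (m + m') n = tens m n + tens m' n.
Proof. by rewrite -tens_of_cat; apply/tens_ofP/tr_addl. Qed.

Lemma tensDr m n n' : tens m (n + n') = tens m n + tens m n'.
Proof. by rewrite -tens_of_cat; apply/tens_ofP/tr_addr. Qed.

Lemma tens_bal m x n : tens (m * iota x) n = tens m (iota x * n).
Proof. by apply/tens_ofP/tr_bal. Qed.

Definition balanced (A : zmodType) (f : M -> M -> A) : Prop :=
  [/\ forall m m' n, f (m + m') n = f m n + f m' n,
      forall m n n', f m (n + n') = f m n + f m n' &
      forall m x n, f (m * iota x) n = f m (iota x * n)].

Definition tlift (A : zmodType) (f : M -> M -> A) (t : tensor) : A :=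
  \sum_(p <- repr t) f p.1 p.2.

Lemma tlift_of (A : zmodType) (f : M -> M -> A) s :
  balanced f -> tlift f (tens_of s) = \sum_(p <- s) f p.1 p.2.
Proof.
case=> fDl fDr fB; rewrite /tlift.
suff sumE u v : tensor_rel u v -> \sum_(p <- u) f p.1 p.2 = \sum_(p <- v) f p.1 p.2.
  by apply: sumE; apply/tens_ofP; rewrite tens_ofK.
elim=> {s u v} //=.
- by move=> s t u _ -> _ ->.
- by move=> s1 s2 t1 t2 _ + _; rewrite !big_cat /= => -> ->.
- by move=> s t; rewrite !big_cat /= addrC.
- move=> n; rewrite big_seq1 big_nil /=.
  by apply: (addrI (f 0 n)); rewrite -fDl !addr0.
- by move=> m m' n; rewrite !big_cons !big_nil !addr0 /=.
- by move=> m n n'; rewrite !big_cons !big_nil !addr0 /=.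
- by move=> m x n; rewrite !big_seq1 /=.
Qed.

Lemma tliftE (A : zmodType) (f : M -> M -> A) m n :
  balanced f -> tlift f (tens m n) = f m n.
Proof. by move=> fb; rewrite tlift_of // big_seq1. Qed.

Lemma tliftD (A : zmodType) (f : M -> M -> A) s t :
  balanced f -> tlift f (s + t) = tlift f s + tlift f t.
Proof.
move=> fb; rewrite -(tens_ofK s) -(tens_ofK t) -tens_of_cat.
by rewrite !tlift_of // big_cat.
Qed.

Lemma additive_sum (A B : zmodType) (f : A -> B) : {morph f : s t / s + t} ->
  forall (I : Type) (r : seq I) (P : pred I) F,
  f (\sum_(i <- r | P i) F i) = \sum_(i <- r | P i) f (F i).
Proof.
move=> fD I r P F; apply: (big_morph f fD).
by apply: (addrI (f 0)); rewrite -fD !addr0.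
Qed.

Lemma tensor_ext (A : zmodType) (f g : tensor -> A) :
  {morph f : s t / s + t} -> {morph g : s t / s + t} ->
  (forall m n, f (tens m n) = g (tens m n)) -> f =1 g.
Proof.
move=> fD gD fg t; rewrite (tensorE t) !additive_sum //.
by apply: eq_bigr.
Qed.

Lemma tensDl_morph n : {morph tens^~ n : m m' / m + m'}.
Proof. by move=> m m'; rewrite tensDl. Qed.

Lemma tensDr_morph m : {morph tens m : n n' / n + n'}.
Proof. by move=> n n'; rewrite tensDr. Qed.

Lemma balanced_lact (g : M -> M) : {morph g : m n / m + n} ->
  (forall m n, g (m * n) = g m * n) -> balanced (fun a b => tens (g a) b).
Proof.
move=> gD gM; split=> [m m' n|m n n'|m x n].
- by rewrite gD tensDl.
- by rewrite tensDr.
- by rewrite gM tens_bal.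
Qed.

Definition tensor_scale (c : k) : tensor -> tensor :=
  tlift (fun a b => tens (c *: a) b).

Definition lact (m : M) : tensor -> tensor := tlift (fun a b => tens (m * a) b).

Definition ract (t : tensor) (m : M) : tensor :=
  tlift (fun a b => tens a (b * m)) t.

Fact scale_bal c : balanced (fun a b => tens (c *: a) b).
Proof. by apply: balanced_lact => [a b|a b]; rewrite ?scalerDr // scalerAl. Qed.

Fact lact_bal m : balanced (fun a b => tens (m * a) b).
Proof. by apply: balanced_lact => [a b|a b]; rewrite ?mulrDr // mulrA. Qed.

Fact ract_bal m : balanced (fun a b => tens a (b * m)).
Proof.
split=> [a a' b|a b b'|a x b]; first by rewrite tensDl.
  by rewrite mulrDl tensDr.
by rewrite tens_bal mulrA.
Qed.

Lemma tensor_scaleE c a b : tensor_scale c (tens a b) = tens (c *: a) b.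
Proof. exact/tliftE/scale_bal. Qed.

Lemma tensor_scaleDr c : {morph tensor_scale c : s t / s + t}.
Proof. by move=> s t; apply/tliftD/scale_bal. Qed.

Lemma lactE m a b : lact m (tens a b) = tens (m * a) b.
Proof. exact/tliftE/lact_bal. Qed.

Lemma lactD m : {morph lact m : s t / s + t}.
Proof. by move=> s t; apply/tliftD/lact_bal. Qed.

Lemma ractE m a b : ract (tens a b) m = tens a (b * m).
Proof. exact/tliftE/ract_bal. Qed.

Lemma ractD m : {morph ract^~ m : s t / s + t}.
Proof. by move=> s t; apply/tliftD/ract_bal. Qed.

Fact tensor_scaleA c d t : tensor_scale c (tensor_scale d t) = tensor_scale (c * d) t.
Proof.
move: t; apply: tensor_ext => [s t|s t|m n]; rewrite ?tensor_scaleDr //.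
by rewrite !tensor_scaleE scalerA.
Qed.

Fact tensor_scale1 : left_id 1 tensor_scale.
Proof.
apply: (@tensor_ext _ _ id) => [s t|s t|m n] //=; first by rewrite tensor_scaleDr.
by rewrite tensor_scaleE scale1r.
Qed.

Fact tensor_scaleDl t : {morph tensor_scale^~ t : c d / c + d}.
Proof.
move=> c d /=; move: t.
apply: tensor_ext => [s t|s t|m n]; rewrite ?tensor_scaleDr //.
  by rewrite !addrA; congr (_ + _); rewrite addrAC.
by rewrite !tensor_scaleE scalerDl tensDl.
Qed.

HB.instance Definition _ := GRing.Zmodule_isLmodule.Build k tensor
  tensor_scaleA tensor_scale1 tensor_scaleDr tensor_scaleDl.

Lemma scale_tens c a b : c *: tens a b = tens (c *: a) b.
Proof. exact: tensor_scaleE. Qed.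

Definition tensor_mult : tensor -> M := tlift *%R.

Fact mult_bal : balanced ( *%R : M -> M -> M).
Proof.
by split=> [a a' b|a b b'|a x b]; rewrite ?mulrDl ?mulrDr // mulrA.
Qed.

Lemma tensor_multE a b : tensor_mult (tens a b) = a * b.
Proof. exact/tliftE/mult_bal. Qed.

Lemma tensor_multD : {morph tensor_mult : s t / s + t}.
Proof. by move=> s t; apply/tliftD/mult_bal. Qed.

End TensorRelation.

Arguments tens {k N M} iota m n.

(* C_M(f(X)) *)
Definition cent (k : fieldType) (M : algType k) (X : Type) (f : X -> M) : {pred M} :=
  [pred m | `[< forall x, f x * m = m * f x >]].

Section CentralizerAlgebra.
Variables (k : fieldType) (M : algType k) (X : Type) (f : X -> M).

Lemma centP m : reflect (forall x, f x * m = m * f x) (m \in cent f).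
Proof. exact: asboolP. Qed.

Fact cent_subalg_closed : subalg_closed (cent f).
Proof.
split; first by apply/centP => x; rewrite mulr1 mul1r.
  move=> c u v /centP Hu /centP Hv; apply/centP => x.
  by rewrite mulrDr mulrDl Hv -scalerAr -scalerAl Hu.
move=> u v /centP Hu /centP Hv; apply/centP => x.
by rewrite mulrA Hu -mulrA Hv mulrA.
Qed.

HB.instance Definition _ :=
  GRing.isSubalgClosed.Build k M (cent f) cent_subalg_closed.

Record cent_alg := CentAlg { cent_val : M; cent_valP : cent_val \in cent f }.
HB.instance Definition _ := [isSub for cent_val].
HB.instance Definition _ := [Choice of cent_alg by <:].
HB.instance Definition _ := [SubChoice_isSubAlgebra of cent_alg by <:].

End CentralizerAlgebra.

Definition central (k : fieldType) (A : algType k) : Prop :=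
  forall z : A, (forall a, z * a = a * z) <-> exists c : k, z = c%:A.

Section Kanzaki.
Variables (k : fieldType) (A : algType k).

Definition tensor_k := tensor (in_alg A : {rmorphism k -> A}).
HB.instance Definition _ := GRing.Lmodule.on tensor_k.

Definition tens_k (a b : A) : tensor_k := tens (in_alg A : {rmorphism k -> A}) a b.

Definition flip : tensor_k -> tensor_k := tlift (fun a b => tens_k b a).

Fact flip_bal : balanced (in_alg A : {rmorphism k -> A}) (fun a b => tens_k b a).
Proof.
split=> [a a' b|a b b'|a c b]; rewrite /tens_k ?tensDl ?tensDr //=.
have -> : a * c%:A = c%:A * a by rewrite -scalerAr mulr1 -scalerAl mul1r.
have -> : c%:A * b = b * c%:A by rewrite -scalerAr mulr1 -scalerAl mul1r.
by rewrite -(tens_bal (in_alg A : {rmorphism k -> A}) b c a).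
Qed.

Lemma flipE a b : flip (tens_k a b) = tens_k b a.
Proof. exact/tliftE/flip_bal. Qed.

Definition separability_element (e : tensor_k) : Prop :=
  (forall a, lact a e = ract e a) /\ tensor_mult e = 1.

Definition Kanzaki_separable : Prop :=
  exists e : tensor_k, separability_element e /\ flip e = e.

End Kanzaki.

Section Extension.
Variables (k : fieldType) (N M : algType k) (iota : {lrmorphism N -> M}).

Definition sub_bimodule (P : M -> Prop) : Prop :=
  [/\ P 0, forall a b, P a -> P b -> P (a - b) &
      forall x a y, P a -> P (iota x * a * iota y)].

Definition is_direct_sum (P Q : M -> Prop) : Prop :=
  forall m, exists! pq : M * M, [/\ P pq.1, Q pq.2 & m = pq.1 + pq.2].

Definition iso_bimodule (P : M -> Prop) : Prop :=
  exists phi : {linear N -> M},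
    [/\ forall x y z, phi (x * y * z) = iota x * phi y * iota z,
        injective phi & forall m, P m <-> exists y, m = phi y].

Definition split_extension : Prop :=
  exists P Q : M -> Prop,
    [/\ sub_bimodule P, sub_bimodule Q, is_direct_sum P Q & iso_bimodule P].

Definition Casimir (f : tensor iota) : Prop := forall m, lact m f = ract f m.

Definition H_separable : Prop :=
  exists (r : nat) (f : 'I_r -> tensor iota) (u : 'I_r -> M),
    [/\ forall i, Casimir (f i), forall i, u i \in cent iota &
        tens iota 1 1 = \sum_i lact (u i) (f i)].

Definition bimodule_map (E : M -> N) : Prop :=
  forall x m y, E (iota x * m * iota y) = x * E m * y.

Definition dual_bases (E : M -> N) (r : nat) (x y : 'I_r -> M) : Prop :=
  forall m, \sum_i iota (E (m * x i)) * y i = m /\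
            \sum_i x i * iota (E (y i * m)) = m.

Record strongly_separable := StronglySeparable {
  ss_E : {linear M -> N};
  ss_lambda : k;
  ss_rank : nat;
  ss_x : 'I_ss_rank -> M;
  ss_y : 'I_ss_rank -> M;
  ss_bimod : bimodule_map ss_E;
  ss_E1 : ss_E 1 = 1;
  ss_dual : dual_bases ss_E ss_x ss_y;
  ss_lambda_neq0 : ss_lambda != 0;
  ss_index : \sum_i ss_x i * ss_y i = ss_lambda^-1%:A
}.

End Extension.

(* M_1 is M (x)_N M as a k-module; its product depends on E, hence on S. *)
Definition basic (k : fieldType) (N M : algType k) (iota : {lrmorphism N -> M})
  (S : strongly_separable iota) : Type := tensor iota.
HB.instance Definition _ (k : fieldType) (N M : algType k)
  (iota : {lrmorphism N -> M}) (S : strongly_separable iota) :=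
  GRing.Lmodule.copy (basic S) (tensor iota).

Section BasicConstruction.
Variables (k : fieldType) (N M : algType k) (iota : {lrmorphism N -> M}).
Variable S : strongly_separable iota.

Local Notation E := (ss_E S).
Local Notation lam := (ss_lambda S).
Local Notation x := (@ss_x _ _ _ _ S).
Local Notation y := (@ss_y _ _ _ _ S).
Local Notation "a '*e*' b" := (tens iota a b) (at level 38).

Local Notation M1 := (basic S).

Definition basic_mul (s t : M1) : M1 :=
  tlift (fun m m' => tlift (fun n n' => (m * iota (E (m' * n))) *e* n') t) s.

Definition basic_one : M1 := \sum_i x i *e* y i.

Lemma E_mul_r m n : E (m * iota n) = E m * n.
Proof. by have:= ss_bimod S 1 m n; rewrite rmorph1 !mul1r. Qed.

Lemma E_mul_l m n : E (iota n * m) = n * E m.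
Proof. by have:= ss_bimod S n m 1; rewrite rmorph1 !mulr1. Qed.

Fact basic_mul_bal2 m m' :
  balanced iota (fun n n' => (m * iota (E (m' * n))) *e* n').
Proof.
split=> [a a' b|a b b'|a z b].
- by rewrite mulrDr raddfD /= raddfD mulrDr tensDl.
- by rewrite tensDr.
- by rewrite mulrA E_mul_r rmorphM mulrA tens_bal.
Qed.

Fact basic_mul_bal1 (t : M1) :
  balanced iota (fun m m' => tlift (fun n n' => (m * iota (E (m' * n))) *e* n') t).
Proof.
have aux (g1 g2 g3 : tensor iota -> M1) : {morph g1 : s t / s + t} ->
  {morph g2 : s t / s + t} -> {morph g3 : s t / s + t} ->
  (forall a b, g1 (a *e* b) = g2 (a *e* b) + g3 (a *e* b)) ->
  forall t, g1 t = g2 t + g3 t.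
  move=> g1D g2D g3D H; apply: (@tensor_ext _ _ _ _ _ g1 (fun t => g2 t + g3 t)) => // s {}t.
  by rewrite g2D g3D addrACA.
have liftD m m' : {morph tlift (iota := iota) (fun n n' => (m * iota (E (m' * n))) *e* n') : s t / s + t}.
  by move=> u v; exact: (tliftD _ _ (basic_mul_bal2 m m')).
have liftE := fun m m' a b => tliftE a b (basic_mul_bal2 m m').
split=> [a a' b|a b b'|a z b].
- by apply: aux => // c d; rewrite !liftE mulrDl tensDl.
- by apply: aux => // c d; rewrite !liftE mulrDl raddfD /= raddfD mulrDr tensDl.
- move: t; apply: tensor_ext => // c d.
  by rewrite !liftE -!mulrA E_mul_l rmorphM.
Qed.

Lemma basic_mulE m m' n n' :
  basic_mul (m *e* m') (n *e* n') = (m * iota (E (m' * n))) *e* n'.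
Proof.
rewrite /basic_mul (tliftE _ _ (basic_mul_bal1 _)).
by rewrite (tliftE _ _ (basic_mul_bal2 _ _)).
Qed.

Fact basic_mulDl : left_distributive basic_mul +%R.
Proof. by move=> s s' t; apply: (tliftD _ _ (basic_mul_bal1 t)). Qed.

Fact basic_mulDr : right_distributive basic_mul +%R.
Proof.
move=> s t t'; rewrite /basic_mul /tlift -big_split; apply: eq_bigr => -[m m'] _ /=.
exact: (tliftD _ _ (basic_mul_bal2 m m')).
Qed.

Fact basic_mulA : associative basic_mul.
Proof.
move=> s t u; move: s; apply: tensor_ext => [s s'|s s'|m m'].
- by rewrite basic_mulDl.
- by rewrite !basic_mulDl.
move: t; apply: tensor_ext => [t t'|t t'|n n'].
- by rewrite basic_mulDl basic_mulDr.
- by rewrite basic_mulDr basic_mulDl.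
move: u; apply: tensor_ext => [u u'|u u'|p p'].
- by rewrite !basic_mulDr.
- by rewrite !basic_mulDr.
by rewrite !basic_mulE mulrA E_mul_r rmorphM !mulrA.
Qed.

Lemma basic_mul_suml (I : Type) (r : seq I) (F : I -> M1) t :
  basic_mul (\sum_(i <- r) F i) t = \sum_(i <- r) basic_mul (F i) t.
Proof.
by apply: (@additive_sum _ _ (basic_mul^~ t)) => s s'; apply: basic_mulDl.
Qed.

Lemma basic_mul_sumr (I : Type) (r : seq I) (F : I -> M1) t :
  basic_mul t (\sum_(i <- r) F i) = \sum_(i <- r) basic_mul t (F i).
Proof.
by apply: additive_sum => s s'; apply: basic_mulDr.
Qed.

Lemma tens_suml (I : Type) (r : seq I) (F : I -> M) n :
  (\sum_(i <- r) F i) *e* n = \sum_(i <- r) F i *e* n.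
Proof. exact: (additive_sum (tensDl_morph iota n)). Qed.

Lemma tens_sumr (I : Type) (r : seq I) (F : I -> M) m :
  m *e* (\sum_(i <- r) F i) = \sum_(i <- r) m *e* F i.
Proof. exact: (additive_sum (tensDr_morph iota m)). Qed.

Definition basic_in (m : M) : M1 := \sum_i (m * x i) *e* y i.

Lemma basic_in_l m n n' : basic_mul (basic_in m) (n *e* n') = (m * n) *e* n'.
Proof.
rewrite basic_mul_suml.
under eq_bigr => i _ do rewrite basic_mulE -mulrA.
by rewrite -tens_suml -mulr_sumr (ss_dual S n).2.
Qed.

Lemma basic_in_r m n n' : basic_mul (n *e* n') (basic_in m) = n *e* (n' * m).
Proof.
rewrite basic_mul_sumr.
under eq_bigr => i _ do rewrite basic_mulE tens_bal mulrA.
by rewrite -tens_sumr (ss_dual S (n' * m)).1.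
Qed.

Lemma basic_in1 : basic_in 1 = basic_one.
Proof. by rewrite /basic_in; under eq_bigr do rewrite mul1r. Qed.

Fact basic_mul1 : left_id basic_one basic_mul.
Proof.
rewrite -basic_in1; apply: (@tensor_ext _ _ _ _ _ _ id) => [s t|s t|m n] //=.
  by rewrite basic_mulDr.
by rewrite basic_in_l mul1r.
Qed.

Fact basic_mulr1 : right_id basic_one basic_mul.
Proof.
rewrite -basic_in1; apply: (@tensor_ext _ _ _ _ _ _ id) => [s t|s t|m n] //=.
  by rewrite basic_mulDl.
by rewrite basic_in_r mulr1.
Qed.

Definition basic_E (t : M1) : M := lam *: tensor_mult t.

Lemma basic_EE m n : basic_E (m *e* n) = lam *: (m * n).
Proof. by rewrite /basic_E tensor_multE. Qed.

Lemma basic_ED : {morph basic_E : s t / s + t}.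
Proof. by move=> s t; rewrite /basic_E tensor_multD scalerDr. Qed.

Fact basic_E_one : basic_E basic_one = 1.
Proof.
rewrite (additive_sum basic_ED); under eq_bigr do rewrite basic_EE.
by rewrite -scaler_sumr ss_index scalerA divff ?scale1r // ss_lambda_neq0.
Qed.

Fact basic_one_neq0 : basic_one != 0.
Proof.
apply/eqP => H; have := basic_E_one; rewrite H.
have -> : basic_E 0 = 0 by apply: (addrI (basic_E 0)); rewrite -basic_ED !addr0.
by move/esym/eqP; rewrite oner_eq0.
Qed.

HB.instance Definition _ := GRing.Zmodule_isNzRing.Build M1
  basic_mulA basic_mul1 basic_mulr1 basic_mulDl basic_mulDr basic_one_neq0.

Lemma basic_prodE m m' n n' : (m *e* m' : M1) * (n *e* n' : M1) =
  (m * iota (E (m' * n))) *e* n'.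
Proof. exact: basic_mulE. Qed.

Fact basic_scaleAl (c : k) (s t : M1) : c *: (s * t) = (c *: s) * t.
Proof.
move: s; apply: tensor_ext => [s s'|s s'|m m']; rewrite ?mulrDl ?scalerDr ?mulrDl //.
move: t; apply: tensor_ext => [s s'|s s'|n n']; rewrite ?mulrDr ?scalerDr //.
by rewrite scale_tens !basic_prodE scale_tens scalerAl.
Qed.

HB.instance Definition _ :=
  GRing.Lmodule_isLalgebra.Build k M1 basic_scaleAl.

Fact basic_scaleAr (c : k) (s t : M1) : c *: (s * t) = s * (c *: t).
Proof.
move: s; apply: tensor_ext => [s s'|s s'|m m']; rewrite ?mulrDl ?scalerDr ?mulrDl //.
move: t; apply: tensor_ext => [s s'|s s'|n n']; rewrite ?scalerDr ?mulrDr ?scalerDr //.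
rewrite scale_tens !basic_prodE scale_tens.
by rewrite -scalerAr linearZ /= linearZ /= -scalerAr.
Qed.

HB.instance Definition _ :=
  GRing.Lalgebra_isAlgebra.Build k M1 basic_scaleAr.

Fact basic_in_linear : linear basic_in.
Proof.
move=> c m n; rewrite /basic_in scaler_sumr -big_split; apply: eq_bigr => i _ /=.
by rewrite mulrDl -scalerAl tensDl scale_tens.
Qed.

HB.instance Definition _ := GRing.isLinear.Build k M M1 _ basic_in
  basic_in_linear.

Fact basic_in_monoid : monoid_morphism basic_in.
Proof.
split=> [|m n]; first exact: basic_in1.
rewrite {2 3}/basic_in mulr_sumr; apply: eq_bigr => i _.
by rewrite [RHS]basic_in_l mulrA.
Qed.

HB.instance Definition _ := GRing.isMonoidMorphism.Build M M1 basic_in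
  basic_in_monoid.

Fact basic_E_linear : linear basic_E.
Proof.
move=> c s t; rewrite basic_ED; congr (_ + _).
move: s; apply: tensor_ext => [s s'|s s'|m m'].
- by rewrite scalerDr basic_ED.
- by rewrite basic_ED scalerDr.
by rewrite scale_tens !basic_EE -scalerAl !scalerA mulrC.
Qed.

HB.instance Definition _ := GRing.isLinear.Build k M1 M _ basic_E
  basic_E_linear.

Lemma basic_lact m (t : M1) : basic_in m * t = lact m t.
Proof.
move: t; apply: tensor_ext => [s t|s t|n n']; rewrite ?mulrDr ?lactD //.
by rewrite lactE [LHS]basic_in_l.
Qed.

Lemma basic_ract m (t : M1) : t * basic_in m = ract t m.
Proof.
move: t; apply: tensor_ext => [s t|s t|n n']; rewrite ?mulrDl ?ractD //.
by rewrite ractE [LHS]basic_in_r.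
Qed.

Fact basic_E_bimod : bimodule_map basic_in basic_E.
Proof.
move=> a t b; move: t; apply: tensor_ext => [s t|s t|n n'].
- by rewrite mulrDr mulrDl basic_ED.
- by rewrite basic_ED mulrDr mulrDl.
by rewrite basic_lact basic_ract lactE ractE !basic_EE -scalerAr -scalerAl !mulrA.
Qed.

Definition basic_x (i : 'I_(ss_rank S)) : M1 := lam^-1 *: (x i *e* 1).
Definition basic_y (i : 'I_(ss_rank S)) : M1 := 1 *e* y i.

Fact basic_dual : dual_bases basic_in basic_E basic_x basic_y.
Proof.
have l0 := ss_lambda_neq0 S.
move=> t; split; move: t; apply: (@tensor_ext _ _ _ _ _ _ id) => [s t|s t|m n] //=.
- rewrite -big_split; apply: eq_bigr => i _ /=.
  by rewrite mulrDl raddfD /= raddfD mulrDl.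
- rewrite -[in RHS](ss_dual S n).1 tens_sumr; apply: eq_bigr => i _.
  rewrite basic_lact -scalerAr linearZ /= basic_prodE basic_EE.
  by rewrite scalerA mulVf // scale1r mulr1 lactE mulr1 tens_bal.
- rewrite -big_split; apply: eq_bigr => i _ /=.
  by rewrite mulrDr raddfD /= raddfD mulrDr.
- rewrite -[in RHS](ss_dual S m).2 tens_suml; apply: eq_bigr => i _.
  rewrite basic_prodE basic_EE basic_ract mul1r.
  rewrite -[ract _ _]basic_ract -scalerAl linearZ /= -scalerAr scalerA mulVf // scale1r.
  by rewrite basic_ract ractE mul1r tens_bal.
Qed.

Fact basic_index : \sum_i basic_x i * basic_y i = lam^-1%:A.
Proof.
rewrite [1](_ : _ = basic_one) // /basic_one scaler_sumr; apply: eq_bigr => i _.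
by rewrite -scalerAl basic_prodE mulr1 ss_E1 rmorph1 mulr1.
Qed.

(* M_1/M is strongly separable of the same index, with conditional            *)
(* expectation E_M.                                                           *)
Definition basic_ss : strongly_separable basic_in :=
  @StronglySeparable k M M1 basic_in basic_E lam (ss_rank S)
    basic_x basic_y basic_E_bimod basic_E_one basic_dual (ss_lambda_neq0 S)
    basic_index.

End BasicConstruction.

Section Depth2.
Variables (k : fieldType) (N M : algType k) (iota : {lrmorphism N -> M}).
Variable S : strongly_separable iota.

Local Notation S1 := (basic_ss S).
Local Notation M1 := (basic S).
Local Notation M2 := (basic S1).

(* The bimodule structures of M_1 and M_2 are those of the inclusions, see       *)
(* [basic_lact] and [basic_ract].                                             *)
Definition algA : {pred M1} := cent (basic_in S \o iota).
Definition algB : {pred M2} := cent (basic_in S1 \o basic_in S).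

Definition depth2 : Prop :=
  (exists (r : nat) (a b : 'I_r -> M1),
     (forall i, a i \in algA /\ b i \in algA) /\
     dual_bases (basic_in S) (basic_E (S := S)) a b) /\
  (exists (r : nat) (a b : 'I_r -> M2),
     (forall i, a i \in algB /\ b i \in algB) /\
     dual_bases (basic_in S1) (basic_E (S := S1)) a b).

End Depth2.

(* Main.v *)
Require Import Defs.
From HB Require Import structures.
From mathcomp Require Import all_boot all_algebra.
From mathcomp Require Import boolp.

Set Implicit Arguments.
Unset Strict Implicit.
Unset Printing Implicit Defensive.
Import GRing.Theory.
Local Open Scope ring_scope.

(** Let U = C_M(N), and let sum_j e_j (x) e'_j be a symmetric separability
    element of U.  Everything is built from the averaging operator
    avg m = sum_j e_j m e'_j on M.

    Averages commute with U.  Since M/N is H-separable and split, the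
    centralizer of U is N ([double_centralizer]), so avg takes its values in N
    and is an N-bimodule projection E : M -> N.  It also follows that U, as an
    algebra, has center Z(N) = k.  Symmetry of the separability element makes E
    trace-like, E (u m) = E (m u) for u in U ([average_trace]).

    Expanding the inner average gives sum_j e_j E(e'_j m) = m w, where
    w = sum_k E(e_k) e'_k is central in U and hence a scalar d
    ([average_dual_scalar]).  It remains to see that d <> 0; this replaces the
    usual appeal to the nondegeneracy of the trace form of a central simple
    algebra.  H-separability together with the trace property gives families
    with m = sum_i E(m a_i) b_i ([average_reproducing]); inserting this for
    m = e'_j in sum_j e_j e'_j = 1 exhibits 1 as a combination of the elements
    sum_j e_j E(e'_j a_i) = d a_i, so d = 0 is impossible
    ([average_dual_neq0]).  Thus e_j and d^-1 e'_j are dual bases for E, of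
    index d^-1 because sum_j e_j e'_j = 1.

    For depth 2, dual bases x_i, y_i that centralize the smaller algebra induce
    dual bases of the next conditional expectation in the tower which
    centralize it too, namely lambda^-1 x_i (x) 1 and 1 (x) y_i
    ([tower_dual_bases]).  For M/N the bases above lie in U.  For M_1/M one
    views M_1 as End(M_N): right multiplications by U commute with left
    multiplications by M, and those by e_j and lambda^-1 e'_j form dual bases
    for E_M ([depth2_of_symmetric]). *)

(** * Symmetric separability elements and averaging *)

Section SymmetricSeparability.
Variables (k : fieldType) (M : algType k).

(** The maps that factor through the tensor square over k.  Balancedness is
    stated with scalars on either side, so that it is visibly stable under
    exchanging the two arguments. *)
Definition bilinear_balanced (V : lmodType k) (A : zmodType) (F : V -> V -> A) :=
  [/\ forall a a' b, F (a + a') b = F a b + F a' b,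
      forall a b b', F a (b + b') = F a b + F a b' &
      forall c a b, F (c *: a) b = F a (c *: b)].

Lemma bilinear_balanced_swap (V : lmodType k) (A : zmodType) (F : V -> V -> A) :
  bilinear_balanced F -> bilinear_balanced (fun a b => F b a).
Proof. by case=> Fl Fr Fc; split=> // c a b; rewrite Fc. Qed.

Lemma bilinear_balanced_mul (g : M -> M) :
  linear g -> bilinear_balanced (fun a b => g a * b).
Proof.
move=> g_lin.
have gD a a' : g (a + a') = g a + g a'.
  by have := g_lin 1 a a'; rewrite !scale1r.
have g0 : g 0 = 0 by apply: (addrI (g 0)); rewrite -gD !addr0.
split=> [a a' b|a b b'|c a b]; first by rewrite gD mulrDl.
  by rewrite mulrDr.
by rewrite -[c *: a]addr0 g_lin g0 addr0 -scalerAl scalerAr.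
Qed.

Variables (X : Type) (f : X -> M).

(** The sum of the e_j (x) e'_j is a symmetric separability element of the
    centralizer U of f.  The identities in the tensor square of U are recorded
    by what they say under bilinear maps on M, since they are only ever used
    through such maps. *)
Record symmetric_separable (r : nat) (e e' : 'I_r -> M) : Prop := SymSep {
  sym_cent : forall j, e j \in cent f;
  sym_cent' : forall j, e' j \in cent f;
  sym_mul1 : \sum_j e j * e' j = 1;
  sym_casimir : forall F : M -> M -> M, bilinear_balanced F ->
    forall u, u \in cent f ->
    \sum_j F (u * e j) (e' j) = \sum_j F (e j) (e' j * u);
  sym_flip : forall F : M -> M -> M, bilinear_balanced F ->
    \sum_j F (e j) (e' j) = \sum_j F (e' j) (e j)
}.

Lemma Kanzaki_symmetric : Kanzaki_separable (cent_alg f) ->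
  exists r (e e' : 'I_r -> M), symmetric_separable e e'.
Proof.
case=> t [[t_cas t_mul] t_flip].
pose s := repr t; pose p (j : 'I_(size s)) := tnth (in_tuple s) j.
have bal (A : zmodType) (F : cent_alg f -> cent_alg f -> A) :
    bilinear_balanced F -> balanced (in_alg (cent_alg f) : {rmorphism k -> _}) F.
  case=> Fl Fr Fc; split=> // a c b /=.
  by rewrite mulr_algl -Fc -scalerAr mulr1.
have lift (A : zmodType) (F : cent_alg f -> cent_alg f -> A) :
    \sum_j F (p j).1 (p j).2 = tlift F t.
  by rewrite /tlift /p -(big_tnth _ _ s xpredT (fun q => F q.1 q.2)).
have valM (a b : cent_alg f) : val (a * b) = val a * val b by exact: rmorphM.
have restr (F : M -> M -> M) : bilinear_balanced F ->
    bilinear_balanced (fun a b : cent_alg f => F (val a) (val b)).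
  case=> Fl Fr Fc; split=> [a a' b|a b b'|c a b].
  - by rewrite raddfD Fl.
  - by rewrite raddfD Fr.
  - by rewrite !linearZ Fc.
exists (size s), (fun j => val (p j).1), (fun j => val (p j).2); split.
- by move=> j; exact: cent_valP.
- by move=> j; exact: cent_valP.
- have <- : val (1 : cent_alg f) = 1 by rewrite rmorph1.
  rewrite -t_mul /tensor_mult -lift raddf_sum; apply: eq_bigr => j _.
  exact/esym/valM.
- move=> F Fb u uU.
  have Gb := restr _ Fb; pose v := CentAlg uU.
  pose G (a b : cent_alg f) := F (val a) (val b).
  have Gl : bilinear_balanced (fun a b => G (v * a) b).
    by case: Gb => Gl Gr Gc; split=> [a a' b|a b b'|c a b];
       rewrite /G ?mulrDr ?Gl ?Gr // -scalerAr Gc.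
  have Gr : bilinear_balanced (fun a b => G a (b * v)).
    by case: Gb => Gl' Gr Gc; split=> [a a' b|a b b'|c a b];
       rewrite /G ?mulrDl ?Gl' ?Gr // -scalerAl Gc.
  transitivity (tlift (fun a b => G (v * a) b) t).
    by rewrite -lift; apply: eq_bigr => j _; rewrite /G valM.
  transitivity (tlift (fun a b => G a (b * v)) t); last first.
    by rewrite -lift; apply: eq_bigr => j _; rewrite /G valM.
  transitivity (tlift G (lact v t)).
    move: (t); apply: tensor_ext => [x y|x y|a b].
    - exact/tliftD/bal.
    - by rewrite lactD (tliftD _ _ (bal _ _ Gb)).
    - by rewrite lactE !tliftE //; exact: bal.
  rewrite t_cas; move: (t); apply: tensor_ext => [x y|x y|a b].
  - by rewrite ractD (tliftD _ _ (bal _ _ Gb)).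
  - exact/tliftD/bal.
  - by rewrite ractE !tliftE //; exact: bal.
- move=> F Fb; have Gb := restr _ Fb.
  pose G (a b : cent_alg f) := F (val a) (val b).
  rewrite (lift _ G) (lift _ (fun a b => G b a)) -[in LHS]t_flip.
  have Gs := bilinear_balanced_swap Gb.
  have fD : {morph @flip _ (cent_alg f) : x y / x + y}.
    by move=> x y; exact/tliftD/flip_bal.
  move: (t); apply: tensor_ext => [x y|x y|a b].
  - by rewrite fD (tliftD _ _ (bal _ _ Gb)).
  - exact/tliftD/bal.
  - by rewrite flipE !tliftE //; exact: bal.
Qed.

Variables (r : nat) (e e' : 'I_r -> M).
Hypothesis es : symmetric_separable e e'.

(** Conjugating the Casimir identity by the flip moves an element of U between
    the inner sides of the two factors instead of the outer ones. *)
Lemma sym_inner (F : M -> M -> M) u : bilinear_balanced F -> u \in cent f ->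
  \sum_j F (e j * u) (e' j) = \sum_j F (e j) (u * e' j).
Proof.
move=> Fb uU; have [Fl Fr Fc] := Fb.
rewrite (sym_flip es (F := fun a b => F (a * u) b)); last first.
  by split=> [a a' b|a b b'|c a b]; rewrite ?mulrDl -?scalerAl.
rewrite -(sym_casimir es (bilinear_balanced_swap Fb) uU).
rewrite (sym_flip es (F := fun a b => F a (u * b))) //.
by split=> [a a' b|a b b'|c a b]; rewrite ?mulrDr -?scalerAr.
Qed.

Definition average (m : M) : M := \sum_j e j * m * e' j.

Fact average_linear : linear average.
Proof.
move=> c m n; rewrite /average scaler_sumr -big_split; apply: eq_bigr => j _ /=.
by rewrite mulrDr mulrDl -scalerAr -scalerAl.
Qed.

HB.instance Definition _ := GRing.isLinear.Build k M M _ average average_linear.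

Lemma average_flip m : average m = \sum_j e' j * m * e j.
Proof.
rewrite /average (sym_flip es (F := fun a b => a * m * b)) //.
by apply: bilinear_balanced_mul => c a b; rewrite mulrDl scalerAl.
Qed.

Lemma average_cent m u : u \in cent f -> u * average m = average m * u.
Proof.
move=> uU; rewrite /average mulr_sumr mulr_suml.
under eq_bigr do rewrite !mulrA.
rewrite (sym_casimir es (F := fun a b => a * m * b)) //.
  by under eq_bigr do rewrite mulrA.
by apply: bilinear_balanced_mul => c a b; rewrite mulrDl scalerAl.
Qed.

(** Inside e_j (u m) e'_j the factor u sits next to e_j, and [sym_inner] carries
    it next to e'_j. *)
Lemma average_trace m u : u \in cent f -> average (u * m) = average (m * u).
Proof.
move=> uU; rewrite /average.
under eq_bigr do rewrite mulrA.
rewrite (sym_inner (F := fun a b => a * m * b)) //.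
  by apply: eq_bigr => j _; rewrite !mulrA.
by apply: bilinear_balanced_mul => c a b; rewrite mulrDl scalerAl.
Qed.

Lemma average1 : average 1 = 1.
Proof. by rewrite -[RHS](sym_mul1 es); apply: eq_bigr => j _; rewrite mulr1. Qed.

Lemma average_bimod m x y : average (f x * m * f y) = f x * average m * f y.
Proof.
rewrite /average mulr_sumr mulr_suml; apply: eq_bigr => j _.
by rewrite !mulrA -(centP _ _ (sym_cent es j)) -!mulrA
  (centP _ _ (sym_cent' es j)).
Qed.

Lemma average_in_cent u : u \in cent f -> average u \in cent f.
Proof.
move=> uU; rewrite rpred_sum // => j _.
by rewrite !rpredM // ?(sym_cent es) ?(sym_cent' es).
Qed.

Hypothesis cent_central : forall z, z \in cent f ->
  (forall u, u \in cent f -> u * z = z * u) -> exists c : k, z = c%:A.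

(** Writing out avg(e'_j m), the sum over j collects into the averages of the
    e_k, which are central in U and hence scalars that move across m.  This
    leaves m w with w = sum_k avg(e_k) e'_k, and w is in turn central in U by
    the trace property. *)
Lemma average_dual_scalar : exists d : k,
  forall m, \sum_j e j * average (e' j * m) = d *: m.
Proof.
have scalar u : u \in cent f -> exists c : k, average u = c%:A.
  move=> uU; apply: cent_central; first exact: average_in_cent.
  by move=> v vU; exact: average_cent.
pose w := \sum_j average (e j) * e' j.
have [||d wE] := cent_central (z := w).
- rewrite rpred_sum // => j _.
  by rewrite rpredM // ?average_in_cent ?(sym_cent es) ?(sym_cent' es).
- move=> u uU; have bal : bilinear_balanced (fun a b => average a * b).
    exact/bilinear_balanced_mul/average_linear.
  transitivity (\sum_j average (e j) * (u * e' j)).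
    by rewrite mulr_sumr; apply: eq_bigr => j _; rewrite !mulrA average_cent.
  rewrite -(sym_inner bal uU).
  under eq_bigr do rewrite -average_trace //.
  rewrite (sym_casimir es bal uU) mulr_suml.
  by apply: eq_bigr => j _; rewrite mulrA.
exists d => m; transitivity (m * w); last by rewrite wE -scalerAr mulr1.
rewrite /average; under eq_bigr do rewrite mulr_sumr.
rewrite exchange_big mulr_sumr; apply: eq_bigr => i _.
have [c cE] := scalar _ (sym_cent es i).
transitivity (average (e i) * m * e' i).
  by rewrite /average !mulr_suml; apply: eq_bigr => j _; rewrite !mulrA.
by rewrite cE mulr_algl mulrA -scalerAr mulr1.
Qed.

(** Turns the right dual basis identity for e, e' into the left one, using
    symmetry, that averages commute with e_j, and the trace property. *)
Lemma average_dual_flip m :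
  \sum_j average (m * e j) * e' j = \sum_j e j * average (e' j * m).
Proof.
rewrite (sym_flip es (F := fun a b => average (m * a) * b)); last first.
  apply: bilinear_balanced_mul => c a b.
  by rewrite mulrDr -scalerAr average_linear.
apply: eq_bigr => j _.
by rewrite -(average_trace _ (sym_cent' es j)) (average_cent _ (sym_cent es j)).
Qed.

End SymmetricSeparability.

(** * The double centralizer property *)

Section DoubleCentralizer.
Variables (k : fieldType) (N M : algType k) (iota : {lrmorphism N -> M}).

(** The summand N of M need not be the image of iota: it may be generated by
    another element z of the centralizer, with projection p normalized by
    p z = 1. *)
Lemma split_retraction : split_extension iota ->
  exists (z : M) (p : M -> N), [/\ z \in cent iota, {morph p : m n / m + n},
    forall m x, p (m * iota x) = p m * x & p z = 1].
Proof.
case=> P [Q [[P0 PB PM] [Q0 QB QM] dec [phi [phiM phi_inj phiP]]]].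
have [p pP] : {p : M -> N & forall m, exists2 q, Q q & m = phi (p m) + q}.
  apply: (@choice _ _ (fun m y => exists2 q, Q q & m = phi y + q)) => m.
  have [[a q] /= [[Pa Qq ->] _]] := dec m.
  by have /phiP[y ->] := Pa; exists y; exists q.
have PQ_uniq y y' q q' : Q q -> Q q' -> phi y + q = phi y' + q' -> y = y'.
  move=> Qq Qq' eq_m; have [pq [_ uniq_pq]] := dec (phi y + q).
  have P_phi v : P (phi v) by apply/phiP; exists v.
  have pqE : pq = (phi y, q) by apply: uniq_pq; split=> /=.
  have pqE' : pq = (phi y', q') by apply: uniq_pq; split=> /=.
  by move: pqE'; rewrite pqE => -[/phi_inj].
have QD a b : Q a -> Q b -> Q (a + b).
  move=> Qa Qb; rewrite -[b]opprK -[- b]sub0r; by apply: (QB) => //; apply: QB.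
exists (phi 1), p; split.
- apply/centP => x; have := phiM x 1 1; have := phiM 1 1 x.
  by rewrite !rmorph1 !mulr1 !mul1r => <- <-.
- move=> m n; have [[q Qq mE] [q' Qq' nE]] := (pP m, pP n).
  have [q2 Qq2 mnE] := pP (m + n).
  apply: (PQ_uniq _ _ q2 (q + q')) => //; first exact: QD.
  by rewrite -mnE {1}mE {1}nE raddfD addrACA.
- move=> m x; have [q Qq mE] := pP m; have [q2 Qq2 mxE] := pP (m * iota x).
  apply: (PQ_uniq _ _ q2 (q * iota x)) => //.
    by have := QM 1 q x Qq; rewrite rmorph1 mul1r.
  rewrite -mxE {1}mE mulrDl; congr (_ + _).
  by have := phiM 1 (p m) x; rewrite rmorph1 !mul1r.
- have [q Qq zE] := pP (phi 1); apply/esym/(PQ_uniq _ _ 0 q) => //.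
  by rewrite addr0.
Qed.

(** Moving c through u_i and the Casimir elements f_i in 1 (x) 1 = sum u_i f_i
    gives c (x) 1 = 1 (x) c.  The map a (x) b |-> p(a z) b, where p and z come
    from the splitting, sends the left side into N and the right side to c. *)
Lemma double_centralizer (c : M) : split_extension iota -> H_separable iota ->
  (forall u, u \in cent iota -> u * c = c * u) -> exists y, c = iota y.
Proof.
move=> /split_retraction[z [p [/centP zU pD pM pz]]] [r [h [u [hC uU one]]]] cU.
have tens_c : tens iota c 1 = tens iota 1 c.
  have <- : lact c (tens iota 1 1) = tens iota c 1 by rewrite lactE mulr1.
  have <- : ract (tens iota 1 1) c = tens iota 1 c by rewrite ractE mul1r.
  have lactM a b (t : tensor iota) : lact a (lact b t) = lact (a * b) t.
    move: t; apply: tensor_ext => [s t|s t|m n]; rewrite ?lactD //.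
    by rewrite !lactE mulrA.
  have lract a b (t : tensor iota) : ract (lact a t) b = lact a (ract t b).
    move: t; apply: tensor_ext => [s t|s t|m n].
    - by rewrite lactD ractD.
    - by rewrite ractD lactD.
    by rewrite lactE !ractE lactE.
  rewrite one (additive_sum (@lactD _ _ _ iota c)).
  rewrite (additive_sum (@ractD _ _ _ iota c)).
  by apply: eq_bigr => i _; rewrite lactM -cU // -lactM hC lract.
have bal : balanced iota (fun a b => iota (p (a * z)) * b).
  split=> [a a' b|a b b'|a x b]; first by rewrite mulrDl pD rmorphD mulrDl.
    by rewrite mulrDr.
  by rewrite -mulrA zU mulrA pM rmorphM mulrA.
exists (p (c * z)).
have := congr1 (tlift (fun a b => iota (p (a * z)) * b)) tens_c.
by rewrite !tliftE // mul1r pz rmorph1 mul1r mulr1.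
Qed.

(** An element that is central in U = C_M(N) lies in C_M(U) = N, and it commutes
    with N, so it is in the center of N. *)
Lemma cent_central_of_central : injective iota -> central N ->
  split_extension iota -> H_separable iota ->
  forall z, z \in cent iota -> (forall u, u \in cent iota -> u * z = z * u) ->
  exists c : k, z = c%:A.
Proof.
move=> iota_inj N_central MNs MNh z /centP zU zC.
have [y yE] := double_centralizer MNs MNh zC.
have [c cE] : exists c : k, y = c%:A.
  by apply/N_central => a; apply: iota_inj; rewrite !rmorphM /= -yE zU.
by exists c; rewrite yE cE linearZ /= rmorph1.
Qed.

End DoubleCentralizer.

(** * Dual bases in the tower of basic constructions *)

Section TowerDualBases.
Variables (k : fieldType).

(** Dual bases that centralize N pass to dual bases that centralize N one step
    further up; depth 2 is obtained by applying this to M/N and to M_1/M. *)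
Lemma tower_dual_bases (N M : algType k) (iota : {lrmorphism N -> M})
    (S : strongly_separable iota) r (a b : 'I_r -> M) :
  (forall i, a i \in cent iota /\ b i \in cent iota) ->
  dual_bases iota (ss_E S) a b ->
  exists r' (a' b' : 'I_r' -> basic S),
    (forall i, a' i \in algA (S := S) /\ b' i \in algA (S := S)) /\
    dual_bases (basic_in S) (basic_E (S := S)) a' b'.
Proof.
move=> abU abE; have l0 := ss_lambda_neq0 S.
exists r, (fun i => (ss_lambda S)^-1 *: tens iota (a i) 1 : basic S).
exists (fun i => tens iota 1 (b i) : basic S); split=> [i|t].
  have [/centP aU /centP bU] := abU i; split; last first.
    apply/centP => x; rewrite /= basic_lact basic_ract lactE ractE mulr1.
    by rewrite -bU -tens_bal mul1r.
  apply: rpredZ; apply/centP => x; rewrite /= basic_lact basic_ract lactE ractE.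
  by rewrite mul1r aU tens_bal mulr1.
split; move: t; apply: (@tensor_ext _ _ _ _ _ _ id) => [s t|s t|m n] //=.
- rewrite -big_split; apply: eq_bigr => i _ /=.
  by rewrite mulrDl raddfD /= raddfD mulrDl.
- rewrite -[in RHS](abE n).1 tens_sumr; apply: eq_bigr => i _.
  rewrite basic_lact -scalerAr linearZ /= basic_prodE basic_EE.
  by rewrite scalerA mulVf // scale1r mulr1 lactE mulr1 tens_bal.
- rewrite -big_split; apply: eq_bigr => i _ /=.
  by rewrite mulrDr raddfD /= raddfD mulrDr.
- rewrite -[in RHS](abE m).2 tens_suml; apply: eq_bigr => i _.
  rewrite basic_prodE basic_EE mul1r linearZ /= -scalerAl -scalerAr scalerA.
  by rewrite mulVf // scale1r basic_ract ractE mul1r tens_bal.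
Qed.

Variables (N M : algType k) (iota : {lrmorphism N -> M}).
Variable S : strongly_separable iota.

Local Notation E := (ss_E S).
Local Notation lam := (ss_lambda S).
Local Notation x := (@ss_x _ _ _ _ S).
Local Notation y := (@ss_y _ _ _ _ S).
Local Notation B := (basic_in S).

(** Under M_1 = End(M_N), a (x) b |-> a E(b _), this is m |-> m u. *)
Definition right_mul (u : M) : basic S := \sum_i tens iota (x i * u) (y i).

(** Left multiplications, which are the image of M, commute with right
    multiplications; on elements, this is an expansion of y_i m in the dual
    bases. *)
Lemma right_mul_casimir u : u \in cent iota -> right_mul u \in cent B.
Proof.
move=> /centP uU; apply/centP => m.
rewrite /right_mul mulr_sumr mulr_suml.
under [RHS]eq_bigr => i _.
  rewrite basic_ract ractE -[y i * m](ss_dual S _).1 tens_sumr.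
  under eq_bigr do rewrite -tens_bal -[x i * u * _]mulrA -uU mulrA.
  over.
rewrite [RHS]exchange_big; apply: eq_bigr => j _ /=.
rewrite -tens_suml -mulr_suml basic_lact lactE mulrA.
by under eq_bigr do rewrite -mulrA; rewrite (ss_dual S _).2.
Qed.

Lemma basic_E_mulr_right_mul a b u : u \in cent iota ->
  (forall m, E (u * m) = E (m * u)) ->
  basic_E (S := S) ((tens iota a b : basic S) * right_mul u) = lam *: (a * u * b).
Proof.
move=> uU trE; rewrite /right_mul mulr_sumr raddf_sum /=.
rewrite -[in RHS]mulrA -[u * b in RHS](ss_dual S _).1 mulr_sumr scaler_sumr.
apply: eq_bigr => i _.
by rewrite basic_prodE basic_EE -mulrA; congr (_ *: (_ * (iota _ * _)));
   rewrite mulrA -trE mulrA.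
Qed.

Lemma basic_E_mull_right_mul a b u : u \in cent iota ->
  basic_E (S := S) (right_mul u * (tens iota a b : basic S)) = lam *: (a * u * b).
Proof.
move=> /centP uU; rewrite /right_mul mulr_suml raddf_sum /=.
rewrite -[a in RHS](ss_dual S _).2 !mulr_suml scaler_sumr.
apply: eq_bigr => i _.
by rewrite basic_prodE basic_EE -[x i * u * _]mulrA -uU !mulrA.
Qed.

(** The elements right_mul e_j and lambda^-1 right_mul e'_j are dual bases for
    E_M: on a (x) b, the factor lambda from E_M cancels, the Casimir element is
    commuted into place between a and b, and what remains is the sum in [unit_sum],
    which is 1 (x) 1 because E is the averaging operator. *)
Lemma depth2_of_symmetric r (e e' : 'I_r -> M) :
  (forall i, x i \in cent iota /\ y i \in cent iota) ->
  symmetric_separable iota e e' ->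
  (forall m, iota (E m) = average e e' m) ->
  (forall u, u \in cent iota -> forall m, E (u * m) = E (m * u)) ->
  depth2 S.
Proof.
move=> xyU es E_avg trE; have l0 := ss_lambda_neq0 S.
split; first by apply: tower_dual_bases xyU _; exact: ss_dual.
have unit_sum (f f' : 'I_r -> M) :
    (forall m, \sum_j f j * m * f' j = iota (E m)) ->
    \sum_j B (f j) * right_mul (f' j) = tens iota 1 1 :> basic S.
  move=> ffE; transitivity (\sum_i tens iota (iota (E (x i))) (y i)).
    under eq_bigr do rewrite /right_mul mulr_sumr.
    rewrite exchange_big; apply: eq_bigr => i _ /=.
    rewrite -ffE tens_suml; apply: eq_bigr => j _.
    by rewrite basic_lact lactE mulrA.
  (* sum_i E(x_i) y_i = 1, by the dual basis identity at 1. *)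
  under eq_bigr do rewrite -[iota _]mul1r tens_bal -[x _]mul1r.
  by rewrite -tens_sumr (ss_dual S 1).1.
have unit1 := unit_sum e e' (fun m => esym (E_avg m)).
have unit2 : \sum_j B (e' j) * right_mul (e j) = tens iota 1 1 :> basic S.
  by apply: unit_sum => m; rewrite E_avg (average_flip es).
have sandwich a b : B a * (tens iota 1 1 : basic S) * B b = tens iota a b.
  by rewrite basic_lact lactE basic_ract ractE mulr1 mul1r.
have eU j := sym_cent es j; have eU' j := sym_cent' es j.
apply: (@tower_dual_bases M (basic S) (basic_in S) (basic_ss S) r
  (fun j => right_mul (e j)) (fun j => lam^-1 *: right_mul (e' j))).
  by move=> j; rewrite rpredZ ?right_mul_casimir.
move=> t; split; move: t;
  apply: (@tensor_ext _ _ _ _ _ _ id) => [s t|s t|m n] //=.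
- rewrite -big_split; apply: eq_bigr => i _ /=.
  by rewrite mulrDl raddfD /= raddfD mulrDl.
- rewrite -[RHS]sandwich -unit1 mulr_sumr mulr_suml; apply: eq_bigr => j _.
  rewrite basic_E_mulr_right_mul //; last exact: trE.
  rewrite linearZ /= -scalerAl -scalerAr scalerA divff // scale1r !rmorphM.
  by rewrite -!mulrA (centP _ _ (right_mul_casimir (eU' j))).
- rewrite -big_split; apply: eq_bigr => i _ /=.
  by rewrite mulrDr raddfD /= raddfD mulrDr.
- rewrite -[RHS]sandwich -unit2 mulr_sumr mulr_suml; apply: eq_bigr => j _.
  rewrite -scalerAl [basic_E _]linearZ /= basic_E_mull_right_mul // scalerA mulVf //.
  rewrite scale1r -(centP _ _ (right_mul_casimir (eU j))) !rmorphM.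
  by rewrite -!mulrA (centP _ _ (right_mul_casimir (eU j))).
Qed.

End TowerDualBases.

(** * The averaging operator of an H-separable extension *)

Section AverageHseparable.
Variables (k : fieldType) (N M : algType k) (iota : {lrmorphism N -> M}).
Variables (r : nat) (e e' : 'I_r -> M).
Hypothesis es : symmetric_separable iota e e'.
Hypothesis Hsep : H_separable iota.

(** Apply a (x) b |-> avg(a) b to 1 (x) m = sum_i u_i f_i m = sum_i u_i m f_i and
    carry u_i to the right end of the average by the trace property. *)
Lemma average_reproducing :
  exists (I : Type) (s : seq I) (a b : I -> M),
  forall m, m = \sum_(i <- s) average e e' (m * a i) * b i.
Proof.
have [q [h [u [hC uU one]]]] := Hsep.
have bal : balanced iota (fun a b => average e e' a * b).
  split=> [a a' b|a b b'|a z b]; first by rewrite raddfD mulrDl.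
    by rewrite mulrDr.
  by have := average_bimod es a 1 z; rewrite rmorph1 !mul1r => ->; rewrite mulrA.
exists ('I_q * (M * M))%type, [seq (i, p) | i <- enum 'I_q, p <- repr (h i)].
exists (fun c => c.2.1 * u c.1), (fun c => c.2.2) => m.
rewrite big_allpairs_dep big_enum /=.
have mE : tlift (fun a b => average e e' a * b) (ract (tens iota 1 1) m) = m.
  by rewrite ractE tliftE // (average1 es) !mul1r.
rewrite -[LHS]mE one (additive_sum (@ractD _ _ _ iota m)).
rewrite (additive_sum (fun s t => tliftD s t bal)); apply: eq_bigr => i _.
transitivity (tlift (fun a b => average e e' a * b) (lact (u i) (lact m (h i)))).
  congr (tlift _ _); rewrite (hC i m); move: (h i).
  apply: tensor_ext => [s t|s t|a b]; rewrite ?(lactD, ractD) //.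
  by rewrite !(lactE, ractE).
rewrite {1}(tensorE (h i)) (additive_sum (@lactD _ _ _ iota m)).
rewrite (additive_sum (@lactD _ _ _ iota (u i))).
rewrite (additive_sum (fun s t => tliftD s t bal)); apply: eq_bigr => p _.
by rewrite !lactE tliftE // (average_trace es _ (uU i)) mulrA.
Qed.

(** If d = 0, then substituting [average_reproducing] for e'_j in
    sum_j e_j e'_j = 1 gives 1 = 0. *)
Lemma average_dual_neq0 d :
  (forall m, \sum_j e j * average e e' (e' j * m) = d *: m) -> d != 0.
Proof.
move=> dE; apply/eqP => d0; have [I [s [a [b repE]]]] := average_reproducing.
have := oner_neq0 M; rewrite -(sym_mul1 es).
under eq_bigr do rewrite [e' _]repE mulr_sumr.
rewrite exchange_big big1 ?eqxx // => i _ /=.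
by under eq_bigr do rewrite mulrA; rewrite -mulr_suml dE d0 scale0r mul0r.
Qed.

End AverageHseparable.

Theorem corollary5p4 (k : fieldType) (N M : algType k)
    (iota : {lrmorphism N -> M}) (iota_inj : injective iota)
    (N_central : central N) (M_central : central M)
    (MN_split : split_extension iota) (MN_Hsep : H_separable iota)
    (U_Kanzaki : Kanzaki_separable (cent_alg iota)) :
  exists S : strongly_separable iota, depth2 S.
Proof.
have [r [e [e' es]]] := Kanzaki_symmetric U_Kanzaki.
have [E EE] : {E : M -> N & forall m, average e e' m = iota (E m)}.
  apply: (@choice _ _ (fun m y => average e e' m = iota y)) => m.
  by apply: double_centralizer => // u; exact: average_cent.
have E_lin : linear E.
  by move=> c m n; apply: iota_inj; rewrite -EE average_linear linearP /= -!EE.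
pose El : {linear M -> N} := HB.pack E (GRing.isLinear.Build k M N _ E E_lin).
have [d dE] := average_dual_scalar es
  (cent_central_of_central iota_inj N_central MN_split MN_Hsep).
have d0 := average_dual_neq0 es MN_Hsep dE.
have E_bimod : bimodule_map iota El.
  move=> x m y; apply: iota_inj.
  by rewrite /= -EE (average_bimod es) !rmorphM /= -EE.
have E1 : El 1 = 1 by apply: iota_inj; rewrite /= -EE (average1 es) rmorph1.
have dual : dual_bases iota El e (fun j => d^-1 *: e' j).
  move=> m; split.
    under eq_bigr do rewrite /= -EE -scalerAr.
    by rewrite -scaler_sumr (average_dual_flip es) dE scalerA mulVf ?scale1r.
  under eq_bigr do rewrite /= -EE -scalerAl linearZ /= -scalerAr.
  by rewrite -scaler_sumr dE scalerA mulVf ?scale1r.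
have index : \sum_j e j * (d^-1 *: e' j) = d^-1%:A.
  by under eq_bigr do rewrite -scalerAr; rewrite -scaler_sumr (sym_mul1 es).
exists (StronglySeparable E_bimod E1 dual d0 index).
apply: (depth2_of_symmetric (e := e) (e' := e')) => //= [j|u uU m].
  by split; rewrite ?rpredZ // ?(sym_cent es) ?(sym_cent' es).
by apply: iota_inj; rewrite -!EE (average_trace es).
Qed.
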